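(* Fix integer constants $2 \le d_{\min} \le d_{\max}$. There exist constants $C>0$ and $N$ (depending only on $d_{\min}$ and $d_{\max}$) such that the following holds for every $n \ge N$. Let $V$ be a set of $n$ vertices with an arbitrary partition $(V_1, V_P)$ into player-1 vertices and probabilistic vertices, let $B \subseteq V$ be an arbitrary target (B\''uchi) set, and let each $v \in V$ have a prescribed out-degree $d_v$ with $d_{\min} \le d_v \le d_{\max}$. Let the edge set be random: for each $v$, independently of all other vertices, the out-neighbour set $E(v)$ is chosen uniformly at random among all $d_v$-element subsets of $V$. Then the expected number of iterations of the classical algorithm for almost-sure winning in MDPs with B\''uchi objective $B$ on the resulting MDP is at most $C \log n$, and its expected running time is at most $C n$; i.e., the expected number of iterations is $O(\log n)$ and the expected running time is $O(n)$.
   Context: An MDP graph consists of a finite directed graph $(V,E)$ together with a partition $(V_1,V_P)$ of $V$ into player-1 vertices and probabilistic vertices (the transition probabilities play no role for the algorithm). For $U \subseteq V$ in a graph $G$, the random attractor $\mathrm{Attr}_P(U)$ is $\bigcup_{i\ge 0} X_i$, where $X_0=U$ and $X_{i+1}= X_i \cup \{v\in V_P : E(v)\cap X_i \neq\emptyset\} \cup \{v \in V_1 : E(v)\subseteq X_i\}$. The classical algorithm for MDPs with B\''uchi objective $B$ works in iterations: starting from $G^1=G$ with vertex set $V^1=V$, in iteration $i$ it (i) computes the set $Z^i$ of vertices of $G^i$ that have a directed path in $G^i$ to a vertex of $B\cap V^i$; (ii) sets $U^i = V^i\setminus Z^i$; if $U^i=\emptyset$ it stops and outputs $Z^i$ (the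 almost-sure winning set), otherwise it removes $\mathrm{Attr}_P(U^i)$ (computed in $G^i$) from $G^i$ to obtain $G^{i+1}$ and proceeds to iteration $i+1$. Each iteration is implemented by graph reachability and alternating reachability in time linear in the size of the current graph. *)

(* Defs.v *)
From HB Require Import structures.
From mathcomp Require Import all_boot all_order all_algebra.
From mathcomp Require Import reals exp.
Set Implicit Arguments. Unset Strict Implicit. Unset Printing Implicit Defensive.
Import Order.TTheory GRing.Theory Num.Theory.

(* An MDP graph on the vertex set 'I_n:
   - [P1 : {set 'I_n}] is the set V_1 of player-1 vertices; V_P is its complement;
   - [E : {ffun 'I_n -> {set 'I_n}}] gives the out-neighbour set E(v).
   A current subgraph G^i is represented by its vertex set [W]; its edges are
   the edges of E with both endpoints in W. *)

Section Algo.
Variable n : nat.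
Variable P1 : {set 'I_n}.
Variable B : {set 'I_n}.
Variable E : {ffun 'I_n -> {set 'I_n}}.

Definition sub_edge (W : {set 'I_n}) : rel 'I_n :=
  fun u v => [&& u \in W, v \in W & v \in E u].

Definition reachB (W : {set 'I_n}) : {set 'I_n} :=
  [set u in W | [exists b in B :&: W, connect (sub_edge W) u b]].

Definition attr_step (W X : {set 'I_n}) : {set 'I_n} :=
  X :|: [set v in W | if v \in P1 then (E v :&: W) \subset X
                      else (E v :&: W :&: X) != set0].

(* Attr_P(U) in G[W]: the increasing chain X_0 = U, X_{i+1} = step X_i
   stabilises after at most n steps, so iterating n times gives the union. *)
Definition attrP (W U : {set 'I_n}) : {set 'I_n} := iter n (attr_step W) U.

Definition graph_size (W : {set 'I_n}) : nat :=
  #|W| + \sum_(v in W) #|E v :&: W|.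

(* Run the algorithm from vertex set W with fuel; returns
   (number of iterations, total cost = sum over iterations of the size of
   the current graph).  Each non-final iteration removes a nonempty set, so
   fuel n.+1 suffices. *)
Fixpoint run (fuel : nat) (W : {set 'I_n}) : nat * nat :=
  let U := W :\: reachB W in
  if U == set0 then (1, graph_size W)
  else match fuel with
       | 0 => (1, graph_size W)
       | fuel'.+1 =>
           let r := run fuel' (W :\: attrP W U) in
           (r.1.+1, graph_size W + r.2)
       end.

Definition iterations : nat := (run n.+1 setT).1.
Definition running_time : nat := (run n.+1 setT).2.

End Algo.

(* The random edge sets: for each v, E(v) is a d_v-element subset of 'I_n,
   chosen independently and uniformly, i.e. E is uniform on this set. *)
Definition edge_space (n : nat) (d : 'I_n -> nat) : {set {ffun 'I_n -> {set 'I_n}}} :=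
  [set E : {ffun 'I_n -> {set 'I_n}} | [forall v, #|E v| == d v]].

Definition expect (R : realType) (n : nat) (d : 'I_n -> nat)
    (X : {ffun 'I_n -> {set 'I_n}} -> nat) : R :=
  (\sum_(E in edge_space d) (X E)%:R) / (#|edge_space d|)%:R.

(* Main.v *)
(** Let Z be the set of vertices that reach B, and k = |Z|. If k = n, a single
    iteration suffices; otherwise only the (at most k) vertices of Z survive the
    first iteration, so at most k + 2 iterations are run and all but the first
    cost O(k) each. It remains to see that 16 ln n < k < n has probability O(1/n).

    Z is closed: a vertex outside Z avoids B and has no out-edge into Z, and a
    vertex of Z outside B has one. For fixed Z these events are independent over
    the vertices. Put y = (n-k)/n and t = y/(1+y); a vertex avoids Z with
    probability q <= y^2 since out-degrees are at least 2. Weighting each closed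
    set by t^|Z| and expanding the product over vertices, the union bound over
    all Z of size k is at most t^-k times a product of factors
    t(1-q) + q <= t + (1-t) y^2 = y (or t <= y, for vertices of B), that is,
    (1+y)^k y^(n-k). For 16 ln n <= k <= n/8 this is at most e^(-k/8) <= n^-2;
    for k > n/8 it is at most (y e^(1-y))^(n-k), where y e^(1-y) is bounded away
    from 1, and the sum over k is O(1/n). *)

Require Import Defs.
From HB Require Import structures.
From mathcomp Require Import all_boot all_order all_algebra.
From mathcomp Require Import reals exp.
From mathcomp Require Import sequences.
From mathcomp Require Import zify ring lra.
Import Order.TTheory GRing.Theory Num.Theory.
Local Open Scope ring_scope.

(** * Deterministic bounds on a run *)

Section Run.
Variables (n : nat) (P1 B : {set 'I_n}) (E : {ffun 'I_n -> {set 'I_n}}).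
Implicit Types W U : {set 'I_n}.

Lemma sub_attrP W U : U \subset attrP P1 E W U.
Proof.
suff sub_iter m : U \subset iter m (attr_step P1 E W) U by exact: sub_iter.
by elim: m => [|m IHm] //=; apply: subset_trans IHm (subsetUl _ _).
Qed.

Lemma sub_reachB W : W :\: attrP P1 E W (W :\: reachB B E W) \subset reachB B E W.
Proof.
apply/subsetP => v; rewrite inE => /andP[vA vW]; apply: contraNT vA => vZ.
by apply: (subsetP (sub_attrP _ _)); rewrite inE vZ.
Qed.

Lemma graph_size_le D W : (forall v, #|E v| <= D)%N ->
  (graph_size E W <= #|W| * D.+1)%N.
Proof.
move=> leED; rewrite mulnS leq_add2l -sum_nat_const; apply: leq_sum => v _.
exact: leq_trans (subset_leq_card (subsetIl _ _)) (leED v).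
Qed.

Lemma proper_reachB W : W :\: reachB B E W != set0 ->
  (#|W :\: attrP P1 E W (W :\: reachB B E W)| < #|W|)%N.
Proof.
case/set0Pn=> v vU; apply: proper_card; apply/properP; split; first exact: subsetDl.
exists v; first by case/setDP: vU.
by rewrite inE (subsetP (sub_attrP _ _) _ vU).
Qed.

Lemma run_iterations_le fuel W : ((run P1 B E fuel W).1 <= #|W|.+1)%N.
Proof.
elim: fuel W => [|m IHm] W /=; case: ifPn => //= /proper_reachB ltW.
by apply: leq_ltn_trans (IHm _) _.
Qed.

(** Each non-final iteration deletes a vertex, so at most [#|W|.+1] graphs occur, each of size at
    most [#|W| * D.+1]. *)
Lemma run_time_le D fuel W : (forall v, #|E v| <= D)%N ->
  ((run P1 B E fuel W).2 <= #|W|.+1 * (#|W| * D.+1))%N.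
Proof.
move=> leED.
have le1 W' : (graph_size E W' <= #|W'|.+1 * (#|W'| * D.+1))%N.
  exact: leq_trans (graph_size_le _ _ leED) (leq_pmull _ _).
elim: fuel W => [|m IHm] W /=; case: ifPn => //= /proper_reachB ltW.
rewrite mulSn leq_add ?graph_size_le //; apply: leq_trans (IHm _) _.
by rewrite leq_mul // leq_mul // ltnW.
Qed.

Lemma iterations_le :
  (iterations P1 B E <= if reachB B E setT == setT then 1 else #|reachB B E setT|.+2)%N.
Proof.
rewrite /iterations /=; case: (eqVneq (reachB B E setT) setT) => [->|nT].
  by rewrite setDv eqxx.
rewrite setTD ifN /=; last by rewrite -(inj_eq (@setC_inj _)) setCK setC0.
rewrite ltnS; apply: leq_trans (run_iterations_le _ _) _.
by rewrite ltnS -setTD subset_leq_card // sub_reachB.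
Qed.

Lemma running_time_le D : (forall v, #|E v| <= D)%N ->
  (running_time P1 B E <= n * D.+1 + if reachB B E setT == setT then 0 else
     #|reachB B E setT|.+1 * (#|reachB B E setT| * D.+1))%N.
Proof.
move=> leED; have leT := graph_size_le _ setT leED.
rewrite cardsT card_ord in leT.
rewrite /running_time /=; case: (eqVneq (reachB B E setT) setT) => [->|nT].
  by rewrite setDv eqxx addn0.
rewrite setTD ifN /=; last by rewrite -(inj_eq (@setC_inj _)) setCK setC0.
rewrite leq_add //; apply: leq_trans (run_time_le _ _ _ leED) _.
rewrite -[~: _]setTD; have le := subset_leq_card (sub_reachB setT).
by rewrite !leq_mul.
Qed.

(** Once [Z] is fixed, the condition at [v] involves [E v] alone; this is what lets the count factor
    over vertices. *)
Lemma reachB_spec v (Z := reachB B E setT) :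
  if v \in Z then (v \in B) || (E v :&: Z != set0)
  else (v \notin B) && (E v :&: Z == set0).
Proof.
have step u w : w \in E u -> w \in Z -> u \in Z.
  rewrite !inE /= => wEu /existsP[b /andP[bB wb]].
  apply/existsP; exists b; rewrite bB /=; apply: connect_trans wb.
  by apply: connect1; rewrite /sub_edge !inE.
case: ifPn => vZ.
  (* An empty path puts [v] in [B]; otherwise its first step [w] still reaches [b]. *)
  move: (vZ); rewrite inE => /andP[_ /existsP[b /andP[bB /connectP[[|w p] /=]]]].
    by move=> _ eq_b; move: bB; rewrite eq_b inE => /andP[->].
  case/andP=> /and3P[_ _ wE] wp lastb; apply/orP; right; apply/set0Pn; exists w.
  rewrite inE wE /= !inE; apply/existsP; exists b; rewrite bB /=.
  by apply/connectP; exists p.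
apply/andP; split.
  apply: contraNN vZ => vB; rewrite !inE; apply/existsP; exists v.
  by rewrite !inE vB connect0.
apply/set0Pn => -[w /setIP[wE wZ]].
by rewrite (step v w) in vZ.
Qed.

End Run.

(** * Counting out-neighbour sets *)

Lemma prodn_card_family (I T : finType) (F : I -> pred T) :
  #|family F| = (\prod_i #|F i|)%N.
Proof. by rewrite card_family foldrE big_map big_enum. Qed.

Lemma card_edge_space n (d : 'I_n -> nat) :
  #|edge_space d| = (\prod_v 'C(n, d v))%N.
Proof.
rewrite (eq_bigr (fun v => #|[pred D : {set 'I_n} | #|D| == d v]|)) => [|v _].
  rewrite -prodn_card_family; apply: eq_card => E; rewrite inE.
  by apply: eq_forallb => v; rewrite inE.
have := card_draws 'I_n (d v); rewrite card_ord => <-.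
by apply: eq_card => D; rewrite !inE.
Qed.

Lemma card_draws_disjoint n (Z : {set 'I_n}) m :
  #|[set D : {set 'I_n} | (#|D| == m) && (D :&: Z == set0)]| = 'C(n - #|Z|, m).
Proof.
have -> : (n - #|Z|)%N = #|~: Z| by rewrite [RHS]cardsCs setCK card_ord.
rewrite -cards_draws; apply: eq_card => D; rewrite !inE andbC.
by rewrite -setD_eq0 setDE setCK.
Qed.

Lemma card_draws_meet n (Z : {set 'I_n}) m :
  (#|[set D : {set 'I_n} | (#|D| == m) && (D :&: Z != set0)]| + 'C(n - #|Z|, m)
    = 'C(n, m))%N.
Proof.
rewrite -card_draws_disjoint.
have := card_draws 'I_n m; rewrite card_ord => <-.
rewrite -(cardsID [set D : {set 'I_n} | D :&: Z != set0] [set A : {set 'I_n} | #|A| == m]).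
by congr (_ + _)%N; apply: eq_card => D; rewrite !inE // negbK andbC.
Qed.

(** After multiplication by [m!] both binomials are falling factorials: the first two factors give
    the squares, the others satisfy [u - i <= n - i]. *)
Lemma bin_mul_sqr_le u n m : (1 < m)%N -> (u <= n)%N ->
  ('C(u, m) * n ^ 2 <= 'C(n, m) * u ^ 2)%N.
Proof.
move=> m1 le_un; rewrite -(leq_pmul2r (fact_gt0 m)) mulnAC [leqRHS]mulnAC !bin_ffact.
case: m m1 => [|[|m]] // _; elim: m => [|m IHm].
  rewrite !ffactnSr !ffactn0 !subn0 !mul1n -!mulnn.
  by rewrite mulnACA [leqRHS]mulnACA [(n * u)%N]mulnC leq_mul //; nia.
rewrite 2!(ffactnSr _ m.+2) mulnAC [leqRHS]mulnAC.
by rewrite leq_mul // leq_sub2r.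
Qed.

(** * Union bound over closed sets of a given size *)

Section ReachCount.
Variables (R : realType) (n : nat) (B : {set 'I_n}) (d : 'I_n -> nat).
Hypothesis d_gt1 : forall v, (1 < d v)%N.

(** Necessary but not sufficient for [Z] to be the reaching set, since cycles that never reach [B]
    may lie in [Z]; a union bound needs no more. *)
Let closed_family (Z : {set 'I_n}) (v : 'I_n) : pred {set 'I_n} :=
  [pred D : {set 'I_n} | (#|D| == d v) && if v \in Z then (v \in B) || (D :&: Z != set0)
                             else (v \notin B) && (D :&: Z == set0)].

(** The counts depend on [Z] only through its size and whether [v] lies in it, so they can serve as
    the two terms of a product of sums. *)
Let weight_in k v : R :=
  if v \in B then 'C(n, d v)%:R else 'C(n, d v)%:R - 'C(n - k, d v)%:R.
Let weight_out k v : R := if v \in B then 0 else 'C(n - k, d v)%:R.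

Lemma card_closed_family Z v : (#|closed_family Z v|%:R : R) =
  if v \in Z then weight_in #|Z| v else weight_out #|Z| v.
Proof.
rewrite /weight_in /weight_out; case: ifP => vZ; case: ifP => vB.
- have := card_draws 'I_n (d v); rewrite card_ord => <-; congr _%:R.
  by apply: eq_card => D; rewrite !inE vZ vB andbT.
- rewrite -(card_draws_meet n Z) natrD addrK; congr _%:R.
  by apply: eq_card => D; rewrite !inE vZ vB.
- apply/eqP; rewrite pnatr_eq0.
  by apply/eqP; apply: eq_card0 => D; rewrite !inE vZ vB andbF.
- rewrite -card_draws_disjoint; congr _%:R.
  by apply: eq_card => D; rewrite !inE vZ vB.
Qed.

Lemma card_reachB_eq k (y := (n - k)%:R / n%:R) : (k < n)%N ->
  #|[set E in edge_space d | #|reachB B E setT| == k]|%:R <=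
    (1 + y) ^+ k * y ^+ (n - k) * #|edge_space d|%:R :> R.
Proof.
move=> ltkn.
have n0 : 0 < n%:R :> R by rewrite ltr0n; lia.
have y0 : 0 < y by rewrite divr_gt0 // ltr0n; lia.
have y1 : 0 < 1 + y by rewrite addr_gt0.
pose t := y / (1 + y).
have t0 : 0 < t by rewrite divr_gt0.
have binle v : 'C(n - k, d v)%:R <= y ^+ 2 * 'C(n, d v)%:R :> R.
  rewrite /y expr_div_n mulrAC ler_pdivlMr ?exprn_gt0 // [leRHS]mulrC -!natrX -!natrM ler_nat.
  by rewrite bin_mul_sqr_le // leq_subr.
have tle v : t * weight_in k v + weight_out k v <= y * 'C(n, d v)%:R.
  rewrite /weight_in /weight_out; case: ifP => _.
    rewrite addr0 ler_wpM2r ?ler0n // ler_pdivrMr //; nra.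
  have -> : y = t + (1 - t) * y ^+ 2 by rewrite /t; field; rewrite gt_eqF.
  have t1 : 0 <= 1 - t by rewrite subr_ge0 ler_pdivrMr //; nra.
  have := ler_wpM2l t1 (binle v); lra.
have le_sum : (#|[set E in edge_space d | #|reachB B E setT| == k]|
    <= \sum_(Z : {set 'I_n} | #|Z| == k) #|family (closed_family Z)|)%N.
  rewrite -sum1_card.
  rewrite (partition_big (fun E => reachB B E setT) (fun Z => #|Z| == k)) /=; last first.
    by move=> E; rewrite !inE => /andP[].
  apply: leq_sum => Z _; rewrite sum1_card; apply: subset_leq_card.
  apply/subsetP => E /andP[]; rewrite inE inE => /andP[/forallP Ed _] /eqP eqZ; rewrite inE.
  apply/familyP => v; rewrite inE Ed /= -eqZ; exact: reachB_spec.
(* Since [t * (1 + y) = y], the factor [t ^+ k] turns the right side into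
   [y ^+ n * #|edge_space d|], a product over vertices. *)
rewrite -(ler_pM2l (exprn_gt0 k t0)).
have -> : t ^+ k * ((1 + y) ^+ k * y ^+ (n - k) * #|edge_space d|%:R) =
          \prod_v (y * 'C(n, d v)%:R).
  rewrite big_split /= prodr_const card_ord card_edge_space natr_prod mulrA; congr (_ * _).
  rewrite mulrA -exprMn /t divfK ?gt_eqF // -exprD; congr (_ ^+ _); lia.
apply: le_trans (_ : \prod_v (t * weight_in k v + weight_out k v) <= _); last first.
  apply: ler_prod => v _; rewrite tle andbT addr_ge0 //.
    rewrite mulr_ge0 ?(ltW t0) // /weight_in; case: ifP => // _.
    by rewrite subr_ge0 ler_nat leq_bin2l // leq_subr.
  by rewrite /weight_out; case: ifP.
(* The expansion runs over all [Z]; the terms with [#|Z| != k] are nonnegative and are dropped. *)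
rewrite bigA_distr.
apply: le_trans (_ : t ^+ k * (\sum_(Z : {set 'I_n} | #|Z| == k)
                                 #|family (closed_family Z)|)%:R <= _).
  by rewrite ler_wpM2l ?exprn_ge0 ?(ltW t0) // ler_nat.
rewrite [leRHS](bigID (fun Z : {set 'I_n} => #|Z| == k)) /= natr_sum mulr_sumr ler_wpDr //.
  apply: sumr_ge0 => Z _; apply: prodr_ge0 => v _.
  rewrite /weight_in /weight_out; case: ifP => _; case: ifP => _ //.
    by rewrite mulr_ge0 // ltW.
  by rewrite mulr_ge0 ?subr_ge0 ?ler_nat ?leq_bin2l ?leq_subr ?(ltW t0).
rewrite le_eqVlt; apply/orP; left; apply/eqP; apply: eq_bigr => Z /eqP cardZ.
rewrite prodn_card_family natr_prod -cardZ -prodr_const big_mkcond -big_split /=.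
by apply: eq_bigr => v _; rewrite card_closed_family; case: ifP; rewrite ?mul1r.
Qed.

End ReachCount.

(** * Real estimates for the tail *)

Section Tail.
Variable R : realType.
Implicit Types x y c : R.

Lemma two_le_expR : 2 <= expR (3 / 4) :> R.
Proof.
have -> : 3 / 4 = 3 / 32 * 8%:R :> R by field.
rewrite expRM_natr.
have h : 1 + 3 / 32 <= expR (3 / 32) :> R := expR_ge1Dx _.
have h0 : 0 <= 1 + 3 / 32 :> R by lra.
apply: le_trans (lerXn2r 8 _ _ h); rewrite ?nnegrE ?expR_ge0 //; lra.
Qed.

(** Here [expR (y - 1)] is at least [y + (1 - y) ^+ 2 / 4], and [224 / 225] is the quotient of [y]
    by this bound at [y = 7 / 8]. *)
Lemma mul_expR_le y : 0 <= y -> y <= 7 / 8 -> y * expR (1 - y) <= 224 / 225.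
Proof.
move=> y0 y1; pose z : R := (y - 1) / 2.
have z1 : 0 <= 1 + z by rewrite /z; lra.
have le_sqr : (1 + z) ^+ 2 <= expR (y - 1).
  have -> : y - 1 = z * 2%:R by rewrite /z; lra.
  by rewrite expRM_natr lerXn2r ?nnegrE ?expR_ge0 // expR_ge1Dx.
have e1 : expR (1 - y) * expR (y - 1) = 1.
  by rewrite -expRD subrKA subrr expR0.
have e0 := expR_gt0 (1 - y).
have : y <= 224 / 225 * expR (y - 1).
  have : (1 + z) ^+ 2 = y + (1 - y) ^+ 2 / 4 by rewrite /z; field.
  nra.
nra.
Qed.

(** A partial sum of the differentiated geometric series; its closed form differs from the limit by
    nonnegative terms. *)
Lemma sum_arith_geom_le c n : 0 <= c -> c < 1 ->
  \sum_(i < n) i.+1%:R * c ^+ i <= ((1 - c) ^+ 2)^-1.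
Proof.
move=> c0 c1; rewrite -[leRHS]mul1r ler_pdivlMr ?exprn_gt0 ?subr_gt0 //.
suff -> : (\sum_(i < n) i.+1%:R * c ^+ i) * (1 - c) ^+ 2 =
          1 - c ^+ n - n%:R * c ^+ n * (1 - c).
  have cn : 0 <= c ^+ n by rewrite exprn_ge0.
  have : 0 <= n%:R * c ^+ n * (1 - c) by rewrite !mulr_ge0 // subr_ge0 ltW.
  lra.
elim: n => [|n IHn]; first by rewrite big_ord0 expr0; ring.
rewrite big_ord_recr /= mulrDl IHn [c ^+ n.+1]exprS -natr1; ring.
Qed.

Lemma tail_term_le n k : (k < n)%N -> 16 * ln n%:R <= k%:R :> R ->
  (1 + (n - k)%:R / n%:R) ^+ k * ((n - k)%:R / n%:R) ^+ (n - k) <=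
  (n%:R ^+ 2)^-1 + expR 1 / n%:R * ((n - k)%:R * (224 / 225) ^+ (n - k).-1) :> R.
Proof.
move=> ltkn lnk; set u := (n - k)%N; set y : R := u%:R / n%:R.
have n0 : 0 < n%:R :> R by rewrite ltr0n; lia.
have u0 : (0 < u)%N by rewrite /u; lia.
have eqn : n%:R = u%:R + k%:R :> R by rewrite -natrD /u subnK // ltnW.
have y0 : 0 < y by rewrite divr_gt0 // ltr0n.
have ny : n%:R * y = u%:R by rewrite /y mulrC divfK // gt_eqF.
have y1 : y <= 1 by rewrite ler_pdivrMr // mul1r ler_nat leq_subr.
clearbody y u.
have [small|big] := leP (8 * k%:R) (n%:R : R).
  apply: ler_wpDr.
    by rewrite !mulr_ge0 ?exprn_ge0 ?invr_ge0 ?expR_ge0 ?ler0n //; lra.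
  have ->: (n%:R ^+ 2)^-1 = expR (- (2 * ln n%:R)) :> R.
    by rewrite expRN expRM_natl lnK.
  (* As [(1 - y) * u = k * u / n >= 7 * k / 8], the exponent is at most [- k / 8 <= - 2 * ln n]. *)
  apply: (@le_trans _ _ (expR (3 / 4) ^+ k * expR (y - 1) ^+ u)).
    rewrite ler_pM ?exprn_ge0 ?lerXn2r ?nnegrE ?expR_ge0 //; try lra.
      have := two_le_expR; lra.
    have := expR_ge1Dx (y - 1); lra.
  rewrite -!expRM_natr -expRD ler_expR; nra.
apply: ler_wpDl; first by rewrite invr_ge0 exprn_ge0 // ltW.
(* Uses [1 + y <= expR y] and [y * k = (1 - y) * u]. *)
apply: (@le_trans _ _ ((y * expR (1 - y)) ^+ u)).
  rewrite exprMn mulrC ler_wpM2l ?exprn_ge0 ?(ltW y0) //.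
  apply: (@le_trans _ _ (expR y ^+ k)).
    by rewrite lerXn2r ?nnegrE ?expR_ge0 ?expR_ge1Dx // addr_ge0 // ltW.
  rewrite -!expRM_natr ler_expR; nra.
have e_le : expR (1 - y) <= expR 1 by rewrite ler_expR; lra.
(* One factor is kept apart: its [y = u / n] supplies the [1 / n]. *)
rewrite -[X in _ ^+ X <= _](prednK u0) exprS.
have -> : expR 1 / n%:R * (u%:R * (224 / 225) ^+ u.-1) = (y * expR 1) * (224 / 225) ^+ u.-1.
  by rewrite -ny; field; rewrite gt_eqF.
have h0 : 0 <= y * expR (1 - y) by rewrite mulr_ge0 ?expR_ge0 // ltW.
rewrite ler_pM ?exprn_ge0 // ?ler_wpM2l ?(ltW y0) // lerXn2r ?nnegrE //; first lra.
apply: mul_expR_le; [exact: ltW | nra].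
Qed.

End Tail.

(** * The exceptional event and expectations *)

Section Expectation.
Variables (R : realType) (n : nat) (B : {set 'I_n}) (d : 'I_n -> nat).
Hypotheses (d_gt1 : forall v, (1 < d v)%N) (d_le : forall v, (d v <= n)%N).
Hypothesis n_gt0 : (0 < n)%N.

Definition mid_reach : {set {ffun 'I_n -> {set 'I_n}}} :=
  [set E in edge_space d | (16 * ln n%:R <= #|reachB B E setT|%:R :> R) &&
                           (#|reachB B E setT| < n)%N].

(** [n] times the sum over [k] of the tail bounds: [n] terms [n ^- 2], plus an arithmetic-geometric
    sum. *)
Definition mid_reach_const : R := 1 + expR 1 * ((1 - 224 / 225) ^+ 2)^-1.

Lemma mid_reach_const_ge0 : 0 <= mid_reach_const.
Proof. by rewrite addr_ge0 // mulr_ge0 ?expR_ge0 ?invr_ge0 ?exprn_ge0 //; lra. Qed.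

Lemma card_mid_reach :
  #|mid_reach|%:R <= mid_reach_const / n%:R * #|edge_space d|%:R :> R.
Proof.
have n0 : 0 < n%:R :> R by rewrite ltr0n.
pose A k := [set E in edge_space d | #|reachB B E setT| == k].
pose large (k : nat) := 16 * ln n%:R <= k%:R :> R.
have le_sum : (#|mid_reach| <= \sum_(k < n | large k) #|A k|)%N.
  rewrite -sum1_card.
  (* The default ordinal is never taken on [mid_reach], where the size is below [n]. *)
  pose f (E : {ffun 'I_n -> {set 'I_n}}) : 'I_n :=
    insubd (Ordinal n_gt0) #|reachB B E setT|.
  rewrite (partition_big f (fun k : 'I_n => large k)) /=; last first.
    by move=> E; rewrite inE => /and3P[_ le16 ltn]; rewrite val_insubd ltn.
  apply: leq_sum => k _; rewrite sum1_card; apply: subset_leq_card.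
  apply/subsetP => E /andP[]; rewrite !inE => /and3P[-> _ ltn] /eqP <- /=.
  by rewrite val_insubd ltn.
have le_sumR : #|mid_reach|%:R <= \sum_(k < n | large k) #|A k|%:R :> R.
  by rewrite -natr_sum ler_nat.
apply: le_trans le_sumR _.
pose F (k : nat) : R :=
  (n%:R ^+ 2)^-1 + expR 1 / n%:R * ((n - k)%:R * (224 / 225) ^+ (n - k).-1).
have F0 k : 0 <= F k.
  by rewrite addr_ge0 ?invr_ge0 ?exprn_ge0 // !mulr_ge0 ?exprn_ge0 ?invr_ge0 ?expR_ge0 //; lra.
apply: le_trans (_ : \sum_(k < n) F k * #|edge_space d|%:R <= _).
  rewrite big_mkcond; apply: ler_sum => k _; case: ifP => [le16|_]; last by rewrite mulr_ge0.
  apply: le_trans (card_reachB_eq R n B d d_gt1 k (ltn_ord k)) _.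
  by rewrite ler_wpM2r // tail_term_le.
rewrite -mulr_suml ler_wpM2r // big_split /= sumr_const card_ord -mulr_sumr.
rewrite /mid_reach_const [X in _ <= X]mulrDl mul1r lerD //.
  by rewrite -[leLHS]mulr_natl expr2 invfM mulrA divff ?gt_eqF // mul1r.
rewrite [leRHS]mulrAC ler_wpM2l ?divr_ge0 ?expR_ge0 //.
(* Reversal turns [n - k] into [i.+1]. *)
rewrite (reindex_inj rev_ord_inj) /=.
apply: le_trans (sum_arith_geom_le _ _ n _ _); try lra.
by rewrite le_eqVlt; apply/orP; left; apply/eqP; apply: eq_bigr => i _; rewrite subKn.
Qed.

(** The exceptional event costs [m] with probability [O(1/n)]: [m] may be of order [n] for
    iterations and [n ^ 2] for time. *)
Lemma expect_le (X : {ffun 'I_n -> {set 'I_n}} -> nat) (a m : R) :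
  0 <= a -> 0 <= m ->
  (forall E, E \in edge_space d -> (X E)%:R <= a + m * (E \in mid_reach)%:R) ->
  expect R d X <= a + m * mid_reach_const / n%:R.
Proof.
move=> a0 m0 leX.
have space0 : 0 < #|edge_space d|%:R :> R.
  by rewrite card_edge_space ltr0n prodn_gt0 // => v; rewrite bin_gt0.
rewrite /expect ler_pdivrMr //.
apply: le_trans (ler_sum _ leX) _.
rewrite big_split /= sumr_const -mulr_sumr mulrDl mulr_natr lerD2l.
have -> : \sum_(E in edge_space d) (E \in mid_reach)%:R = #|mid_reach|%:R :> R.
  rewrite -natr_sum -sum1_card; congr _%:R.
  rewrite -big_mkcondr; apply: eq_bigl => E.
  by apply: andb_idl; rewrite inE => /andP[].
by rewrite -[m * _ / _]mulrA -mulrA ler_wpM2l // card_mid_reach.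
Qed.

Lemma reachB_trichotomy E : E \in edge_space d ->
  [\/ reachB B E setT = setT, #|reachB B E setT|%:R <= 16 * ln n%:R :> R |
      E \in mid_reach /\ (#|reachB B E setT| < n)%N].
Proof.
move=> Ed; have [eqT|nT] := eqVneq (reachB B E setT) setT; first exact: Or31.
have ltn : (#|reachB B E setT| < n)%N.
  rewrite ltn_neqAle (leq_trans (max_card _)) ?card_ord // andbT.
  apply: contraNN nT => /eqP eqn.
  by rewrite eqEcard subsetT cardsT card_ord -{1}eqn leqnn.
have [le16|/ltW] := leP (16 * ln n%:R) (#|reachB B E setT|%:R : R); last exact: Or32.
by apply: Or33; rewrite inE Ed le16 ltn.
Qed.

End Expectation.

(** * Constants and the two bounds *)

Theorem theorem1 (R : realType) (dmin dmax : nat) :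
  (2 <= dmin)%N -> (dmin <= dmax)%N ->
  exists C : R, 0 < C /\
  exists N : nat, forall n : nat, (N <= n)%N ->
    forall (P1 B : {set 'I_n}) (d : 'I_n -> nat),
      (forall v, dmin <= d v <= dmax)%N ->
      expect R d (fun E => iterations P1 B E) <= C * ln (n%:R) /\
      expect R d (fun E => running_time P1 B E) <= C * n%:R.
Proof.
move=> dmin2 dmin_max; pose K := mid_reach_const R.
have K0 : 0 <= K := mid_reach_const_ge0 R.
have ln2 : 0 < ln 2%:R :> R by rewrite ln_gt0 // ltr1n.
(* In [C1], additive constants are absorbed by [ln n >= ln 2]. In [C2], [z <= 16 * ln n] gives
   [z ^ 2 <= 512 * n], and 1026 leaves room for [n + 2 * 512 * n + 1]. *)
pose C1 := 16 + (2 + 2 * K) / ln 2%:R; pose C2 := (1026 + 2 * K) * dmax.+1%:R.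
have C1_gt0 : 0 < C1 by rewrite ltr_pwDl ?divr_ge0 ?(ltW ln2) //; lra.
have C2_ge0 : 0 <= C2 by rewrite mulr_ge0 //; lra.
exists (C1 + C2); split; first exact: ltr_pwDl.
(* [dmax <= n] makes the edge space nonempty; [2 <= n] keeps [ln n] away from 0. *)
exists (maxn dmax 2) => n; rewrite geq_max => /andP[dmax_n n2] P1 B d d_bounds.
have n_gt0 : (0 < n)%N by lia.
have n0 : 0 < n%:R :> R by rewrite ltr0n.
have n1 : 1 <= n%:R :> R by rewrite ler1n.
have d_gt1 v : (1 < d v)%N by have := d_bounds v; lia.
have d_le v : (d v <= n)%N by have := d_bounds v; lia.
have lnn : ln 2%:R <= ln n%:R :> R by rewrite ler_ln ?posrE ?ltr0n // ler_nat.
have lnn0 : 0 < ln n%:R :> R := lt_le_trans ln2 lnn.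
have tri := reachB_trichotomy R n B d; have Ele := expect_le R n B d d_gt1 d_le n_gt0.
split.
  apply: le_trans (Ele _ (16 * ln n%:R + 2) (2 * n%:R) _ _ _) _; try lra.
    move=> E Ed; have := iterations_le n P1 B E.
    have m0 : 0 <= 2 * n%:R * (E \in mid_reach R n B d)%:R :> R by rewrite !mulr_ge0 // ltW.
    have := tri E Ed; case: eqVneq => [_ _ it|nT].
      have : (iterations P1 B E)%:R <= 1 :> R by rewrite -[1]/(1%:R) ler_nat.
      lra.
    move=> Ez; rewrite -(ler_nat R) -[_.+2]addn2 natrD => it.
    case: Ez => [eqT|le16|[Em ltn]]; first by rewrite eqT eqxx in nT.
    - lra.
    - have : #|reachB B E setT|%:R <= n%:R :> R by rewrite ler_nat ltnW.
      rewrite Em mulr1; lra.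
  have -> : 2 * n%:R * mid_reach_const R / n%:R = 2 * K by rewrite /K; field; rewrite gt_eqF.
  have : 2 + 2 * K <= (2 + 2 * K) / ln 2%:R * ln n%:R.
    by rewrite mulrAC ler_pdivlMr // ler_wpM2l //; lra.
  rewrite /C1; have : 0 <= C2 * ln n%:R by rewrite mulr_ge0 // ltW.
  lra.
set D1 : R := dmax.+1%:R.
have D1_0 : 0 <= D1 by rewrite ler0n.
have leED E : E \in edge_space d -> forall v, (#|E v| <= dmax)%N.
  by rewrite inE => /forallP Ed v; rewrite (eqP (Ed v)); case/andP: (d_bounds v).
(* From the quadratic term of the exponential series at [ln n]. *)
have ln_sqr : ln n%:R ^+ 2 <= 2 * n%:R :> R.
  have := expR_ge1Dxn 1 (ltW lnn0); rewrite lnK ?posrE // => h.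
  have : (2`!%:R : R) = 2 by [].
  move=> e2; rewrite e2 in h; lra.
apply: le_trans (Ele _ (1026 * n%:R * D1) (2 * n%:R ^+ 2 * D1) _ _ _) _.
- by rewrite !mulr_ge0 // ltW.
- by rewrite !mulr_ge0 ?exprn_ge0 // ltW.
- move=> E Ed; have := running_time_le n P1 B E dmax (leED E Ed).
  rewrite -(ler_nat R) natrD natrM -/D1 => rt; apply: le_trans rt _.
  have := tri E Ed; case: eqVneq => [_ _|nT].
    rewrite addr0 ler_wpDr ?mulr_ge0 ?exprn_ge0 ?(ltW n0) //.
    by rewrite ler_wpM2r //; lra.
  set z := #|_|; rewrite !natrM -/D1 -[z.+1%:R]natr1 => -[eqT|le16|[-> ltn]].
  - by rewrite eqT eqxx in nT.
  - rewrite ler_wpDr ?mulr_ge0 ?exprn_ge0 ?(ltW n0) //.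
    rewrite mulrA -mulrDl ler_wpM2r //.
    have z0 : 0 <= z%:R :> R by [].
    have zz : z%:R * z%:R <= (16 * ln n%:R) * (16 * ln n%:R) :> R by rewrite ler_pM.
    have : 0 <= (z%:R - 1) ^+ 2 :> R by rewrite sqr_ge0.
    nra.
  - have zn : z%:R + 1 <= n%:R :> R by rewrite natr1 ler_nat.
    have z0 : 0 <= z%:R :> R by [].
    rewrite mulr1 !mulrA -!mulrDl ler_wpM2r //; nra.
have -> : 2 * n%:R ^+ 2 * D1 * mid_reach_const R / n%:R = 2 * K * D1 * n%:R.
  by rewrite /K; field; rewrite gt_eqF.
have : 0 <= C1 * n%:R by rewrite mulr_ge0 // ltW.
rewrite /C2 -/D1; lra.
Qed.
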